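(* The rational circle graph $\mathcal{C}_{\mathbb{Q}}$ is a strongly universal element for the class of countable circle graphs; that is, $\mathcal{C}_{\mathbb{Q}}$ is itself a countable circle graph, and every countable circle graph is isomorphic to an induced subgraph of $\mathcal{C}_{\mathbb{Q}}$.
   Context: A chord of the unit circle $\mathbb{S}^1\subset\mathbb{R}^2$ is a (closed) straight line segment joining two distinct points of $\mathbb{S}^1$. A circle graph is a graph isomorphic to the intersection graph of a set of chords of $\mathbb{S}^1$: the graph whose vertices are these chords, in which two distinct chords are adjacent if and only if they intersect (either at a point of $\mathbb{S}^1$ or at a point inside it). Identify $\mathbb{S}^1$ with the space obtained from $[0,1]$ by identifying $0$ with $1$, and let $\mathbb{Q}^1\subset\mathbb{S}^1$ be the set of rational points under this identification. The rational circle graph $\mathcal{C}_{\mathbb{Q}}$ is the intersection graph of the set of all chords with both endpoints in $\mathbb{Q}^1$. A graph $U$ is strongly universal for a class of graphs containing $U$ if every graph in the class is (isomorphic to) an induced subgraph of $U$. *)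

(* Defs.v *)
From mathcomp Require Import all_boot all_order all_algebra.
From mathcomp Require Import all_classical all_reals all_analysis.

Set Implicit Arguments.
Unset Strict Implicit.
Unset Printing Implicit Defensive.

Import Order.TTheory GRing.Theory Num.Theory.

Local Open Scope classical_set_scope.
Local Open Scope ring_scope.

Record graph := Graph {
  vertex :> Type;
  adj : vertex -> vertex -> Prop;
  adj_sym : forall x y, adj x y -> adj y x;
  adj_irrefl : forall x, ~ adj x x }.

Definition isomorphic (G H : graph) : Prop :=
  exists2 f : G -> H, bijective f & forall x y, adj (f x) (f y) <-> adj x y.

Section InducedSubgraph.
Variables (G : graph) (W : set G).

Let induced_adj (x y : W) : Prop := adj (val x) (val y).

Lemma induced_adj_sym x y : induced_adj x y -> induced_adj y x.
Proof. exact: adj_sym. Qed.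

Lemma induced_adj_irrefl x : ~ induced_adj x x.
Proof. exact: adj_irrefl. Qed.

Definition induced_subgraph : graph :=
  Graph induced_adj_sym induced_adj_irrefl.

End InducedSubgraph.

Section IntersectionGraph.
Variables (T : Type) (A : set (set T)).

Let meets (C D : A) : Prop := C <> D /\ val C `&` val D !=set0.

Lemma meets_sym C D : meets C D -> meets D C.
Proof. by move=> [CD]; rewrite setIC => ?; split=> // /esym. Qed.

Lemma meets_irrefl C : ~ meets C C.
Proof. by case. Qed.

Definition intersection_graph : graph := Graph meets_sym meets_irrefl.

End IntersectionGraph.

(* "Countable" means finite or countably infinite. *)
Definition countable_graph (G : graph) : Prop := countable [set: G].

Definition strongly_universal (K : graph -> Prop) (U : graph) : Prop :=
  K U /\
  forall G : graph, K G ->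
    exists W : set U, isomorphic G (induced_subgraph W).

Section CircleGraphs.
Variable R : realType.

Definition unit_circle : set 'rV[R]_2 :=
  [set p | p 0 0 ^+ 2 + p 0 1 ^+ 2 = 1].

Definition closed_segment (p q : 'rV[R]_2) : set 'rV[R]_2 :=
  [set (1 - t) *: p + t *: q | t in `[0, 1]].

Definition chords_between (E : set 'rV[R]_2) : set (set 'rV[R]_2) :=
  [set C | exists p q, [/\ E p, E q, p <> q & C = closed_segment p q]].

Definition chords : set (set 'rV[R]_2) := chords_between unit_circle.

Definition circle_graph (G : graph) : Prop :=
  exists2 A : set (set 'rV[R]_2),
    A `<=` chords & isomorphic G (intersection_graph A).

(* t |-> (cos (2 pi t), sin (2 pi t)) induces the identification of
   [0, 1] / (0 ~ 1) with the unit circle. *)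
Definition circle_point (t : R) : 'rV[R]_2 :=
  \row_(i < 2) (if i == 0 then cos (2 * pi * t) else sin (2 * pi * t)).

Definition rational_points : set 'rV[R]_2 :=
  [set circle_point (ratr r) | r in [set r : rat | 0 <= r <= 1]].

Definition rational_circle_graph : graph :=
  intersection_graph (chords_between rational_points).

End CircleGraphs.

(* Main.v *)
(* Parametrising the circle by [0, 1[, two chords meet exactly when their
   endpoints are not separated in the order of [0, 1[, even if they share an
   endpoint. The endpoints of countably many chords form a countable set of
   reals, and a strictly increasing map from it to the rationals of [0, 1[
   therefore carries the given chords to rational chords with the same
   intersection pattern. The position of three points on the circle is read
   off the sign of their orientation determinant, which factors as
   4 sin (pi (b - a)) sin (pi (c - b)) sin (pi (c - a)). *)

Require Import Defs.
From mathcomp Require Import all_boot all_order all_algebra.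
From mathcomp Require Import all_classical all_reals all_analysis.
From mathcomp Require Import ring lra.

Set Implicit Arguments.
Unset Strict Implicit.
Unset Printing Implicit Defensive.

Import Order.TTheory GRing.Theory Num.Theory.

Local Open Scope classical_set_scope.
Local Open Scope ring_scope.

(** * Order embedding of a countable set into the rationals of [[0, 1[] *)

(* [order_code c S x] sums [2 ^- (i + 1)] over the codes [i <= c x] of the
   elements [y <= x] of [S]; the bound [i <= c x] keeps the sum finite, and
   since each weight equals the sum of all the later ones, the terms it
   discards do not spoil strict monotonicity. *)
Definition order_code d (T : orderType d) (S : set T) (c : T -> nat) (x : T)
    : rat :=
  \sum_(i < (c x).+1 | `[< exists y, [/\ S y, c y = i & (y <= x)%O] >])
    2%:R ^- i.+1.

(** Since [2 ^- k] is twice [2 ^- k.+1], the partial sums [A k] increase with [k] while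
    [A k + 2 ^- k] decrease. Comparing [m] with [n] leaves a gap of [2 ^- n] or [2 ^- m], hence the
    strict inequality. *)
Lemma binary_sum_tail (P : pred nat) (m n : nat) :
  \sum_(i < n | P i) 2%:R ^- i.+1 <
    \sum_(i < m | P i) 2%:R ^- i.+1 + 2%:R ^- m :> rat.
Proof.
pose A k : rat := \sum_(i < k | P i) 2%:R ^- i.+1.
have w_gt0 k : 0 < 2%:R ^- k :> rat by rewrite invr_gt0 exprn_gt0.
have AS k : A k.+1 = A k + (if P k then 2%:R ^- k.+1 else 0).
  by rewrite /A [LHS]big_mkcond big_ord_recr /= -big_mkcond.
have w2 k : 2%:R ^- k = 2%:R ^- k.+1 + 2%:R ^- k.+1 :> rat.
  by rewrite exprS; field; rewrite expf_neq0.
have A_homo : {homo A : k l / (k <= l)%N >-> k <= l}.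
  apply: homo_leq => [//|x y z|k]; first exact: le_trans.
  by rewrite AS lerDl; case: ifP => // _; apply: ltW.
have Aw_homo : {homo (fun k => A k + 2%:R ^- k) : k l / (k <= l)%N >-> l <= k}.
  apply: (homo_leq (r := fun x y => y <= x)) => [//|x y z yx zy|k].
    exact: le_trans zy yx.
  rewrite AS [in leRHS]w2 addrA lerD2r lerD2l.
  by case: ifP => // _; apply: ltW.
rewrite -/(A n) -/(A m); have [mn|/ltnW nm] := leqP m n.
  by apply: lt_le_trans (Aw_homo _ _ mn); rewrite ltrDl.
by apply: le_lt_trans (A_homo _ _ nm) _; rewrite ltrDl.
Qed.

Section OrderCode.
Variables (d : Order.disp_t) (T : orderType d) (S : set T) (c : T -> nat).
Hypothesis c_inj : {in S &, injective c}.

Lemma order_code_itv x : 0 <= order_code S c x < 1.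
Proof.
apply/andP; split; first by apply: sumr_ge0 => i _; rewrite invr_ge0 exprn_ge0.
have := binary_sum_tail
  (fun i => `[< exists y, [/\ S y, c y = i & (y <= x)%O] >]) 0 (c x).+1.
by rewrite big_ord0 add0r expr0 invr1.
Qed.

Lemma order_code_lt x y : S x -> S y -> (x < y)%O ->
  order_code S c x < order_code S c y.
Proof.
move=> Sx Sy xy; rewrite /order_code.
set P := fun z i => `[< exists t, [/\ S t, c t = i & (t <= z)%O] >].
(* Cut the sum of [x] after index [c y]. The discarded tail is less than [2 ^- (c y).+1], which is
   the term that [y] itself contributes to its own sum and, by injectivity of [c], not to that of
   [x]. *)
apply: lt_le_trans (binary_sum_tail (P x) (c y).+1 _) _.
rewrite [X in X + _]big_mkcond [leRHS]big_mkcond !big_ord_recr /=.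
rewrite -/(P x (c y)) -/(P y (c y)).
have -> : P x (c y) = false.
  apply/asboolP => -[z [Sz czy zx]].
  have zy : z = y by apply: c_inj => //; apply/mem_set.
  by move: zx; rewrite zy leNgt xy.
have -> : P y (c y) by apply/asboolP; exists y.
rewrite addr0 lerD2r; apply: ler_sum => i _.
have w_ge0 : 0 <= 2%:R ^- i.+1 :> rat by rewrite invr_ge0 exprn_ge0.
case: ifP => [/asboolP[z [Sz cz zx]]|_]; last by case: ifP.
rewrite ifT //; apply/asboolP; exists z; split=> //.
exact: le_trans zx (ltW xy).
Qed.

End OrderCode.

Lemma countable_order_embedding d (T : orderType d) (S : set T) :
  countable S ->
  exists f : T -> rat, (forall x, 0 <= f x < 1) /\
    {in S &, {mono f : x y / (x <= y)%O >-> x <= y}}.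
Proof.
move=> /countable_injP[c c_inj]; exists (order_code S c).
split=> [x|]; first exact: order_code_itv.
apply: le_mono_in => x y /set_mem Sx /set_mem Sy; exact: order_code_lt.
Qed.

(** * Segments in the plane and the orientation determinant *)

Section Plane.
Variable R : realType.
Implicit Types p q r u v z : 'rV[R]_2.

Lemma eq_row2 p q : p 0 0 = q 0 0 -> p 0 1 = q 0 1 -> p = q.
Proof.
move=> e0 e1; apply/rowP => -[[|[|//]] i].
  by rewrite (_ : Ordinal i = 0) //; apply: val_inj.
by rewrite (_ : Ordinal i = 1) //; apply: val_inj.
Qed.

(** Twice the signed area of the triangle [p q r], positive when it runs counterclockwise. *)
Definition orient p q r : R :=
  (q 0 0 - p 0 0) * (r 0 1 - p 0 1) - (q 0 1 - p 0 1) * (r 0 0 - p 0 0).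

Lemma closed_segment_left p q : closed_segment p q p.
Proof.
exists 0; first by rewrite /= in_itv /= lexx ler01.
by rewrite subr0 scale1r scale0r addr0.
Qed.

Lemma closed_segment_right p q : closed_segment p q q.
Proof.
exists 1; first by rewrite /= in_itv /= lexx ler01.
by rewrite subrr scale1r scale0r add0r.
Qed.

Lemma closed_segmentC p q : closed_segment p q = closed_segment q p.
Proof.
suff sub p' q' : closed_segment p' q' `<=` closed_segment q' p'.
  by apply/seteqP; split.
move=> z [t]; rewrite /= in_itv /= => /andP[t0 t1] <-.
exists (1 - t); first by rewrite /= in_itv /=; lra.
by rewrite subKr addrC.
Qed.

(** [orient p q] is affine and vanishes on the line through [p] and [q], but keeps one strict sign
    between [u] and [v]. *)
Lemma closed_segments_disjoint p q u v :
  0 < orient p q u * orient p q v ->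
  ~ (closed_segment p q `&` closed_segment u v !=set0).
Proof.
move=> same [z [[t _ <-] [t' /= + /rowP e]]].
rewrite in_itv /= => /andP[t'0 t'1].
have := e 0; have := e 1; rewrite !mxE => e1 e0.
have : (1 - t') * orient p q u + t' * orient p q v = 0.
  transitivity ((q 0 0 - p 0 0) * ((1 - t') * u 0 1 + t' * v 0 1 - p 0 1)
    - (q 0 1 - p 0 1) * ((1 - t') * u 0 0 + t' * v 0 0 - p 0 0)).
    by rewrite /orient; ring.
  by rewrite e1 e0; ring.
move: same; move: (orient p q u) (orient p q v) => x y xy s.
(* Multiplying by [x] avoids a case split on signs: both summands become nonnegative. *)
have sx : (1 - t') * x ^+ 2 + t' * (x * y) = 0.
  by rewrite -[RHS](mulr0 x) -s; ring.
have x2 : 0 <= (1 - t') * x ^+ 2 by rewrite mulr_ge0 ?sqr_ge0 ?subr_ge0.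
have [t0|t0] := eqVneq t' 0.
  by move: s xy; rewrite t0 subr0 mul1r mul0r addr0 => ->; rewrite mul0r ltxx.
have : 0 < t' * (x * y) by rewrite mulr_gt0// lt_neqAle eq_sym t0.
lra.
Qed.

Lemma closed_segments_cross p q u v :
  orient p q u * orient p q v < 0 -> orient u v p * orient u v q < 0 ->
  closed_segment p q `&` closed_segment u v !=set0.
Proof.
(* [x / (x - y)] is the zero of the affine function with values [x] at 0 and [y] at 1; it gives the
   parameter of the crossing point on each segment. *)
have between (x y : R) : x * y < 0 -> x - y != 0 /\ 0 <= x / (x - y) <= 1.
  move=> xy; have d2 : 0 < (x - y) ^+ 2 by nra.
  have d0 : x - y != 0 by move: d2; rewrite exprn_even_gt0.
  split=> //; have -> : x / (x - y) = x * (x - y) / (x - y) ^+ 2 by field.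
  by rewrite ler_pdivlMr// ler_pdivrMr//; apply/andP; split; nra.
move=> /between[+ t'01] /between[+ t01] => d' d.
exists ((1 - orient u v p / (orient u v p - orient u v q)) *: p
        + (orient u v p / (orient u v p - orient u v q)) *: q).
split; first by exists (orient u v p / (orient u v p - orient u v q)).
exists (orient p q u / (orient p q u - orient p q v)) => //.
move: d d'; rewrite /orient => d d'.
by apply: eq_row2; rewrite !mxE; field; rewrite d d'.
Qed.

Lemma unit_circle_strictly_convex p q z : unit_circle p -> unit_circle q ->
  unit_circle z -> closed_segment p q z -> z = p \/ z = q.
Proof.
rewrite /unit_circle /= => Up Uq Uz [t _ ez]; move: Uz.
rewrite -ez !mxE => Uz.
have [t0|t0] := eqVneq t 0.
  by left; rewrite t0 subr0 scale1r scale0r addr0.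
have [t1|t1] := eqVneq t 1.
  by right; rewrite t1 subrr scale1r scale0r add0r.
have t1' : 1 - t != 0 by rewrite subr_eq0 eq_sym.
(* For [p], [q] on the circle, the point [z] at parameter [t] satisfies
   [1 - |z|^2 = t (1 - t) |p - q|^2]. *)
have : t * (1 - t) * ((p 0 0 - q 0 0) ^+ 2 + (p 0 1 - q 0 1) ^+ 2) = 0.
  transitivity ((1 - t) * (p 0 0 ^+ 2 + p 0 1 ^+ 2)
    + t * (q 0 0 ^+ 2 + q 0 1 ^+ 2)
    - (((1 - t) * p 0 0 + t * q 0 0) ^+ 2
       + ((1 - t) * p 0 1 + t * q 0 1) ^+ 2)); first by ring.
  by rewrite Up Uq Uz; ring.
move/eqP; rewrite !mulf_eq0 (negPf t0) (negPf t1') /=.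
rewrite paddr_eq0 ?sqr_ge0// !sqrf_eq0 !subr_eq0 => /andP[/eqP e0 /eqP e1].
have -> : p = q by exact: eq_row2.
by left; rewrite -scalerDl subrK scale1r.
Qed.

(** A chord meets the circle only at its endpoints, so as a point set it determines them up to
    order. *)
Lemma chord_endpoints p q u v : unit_circle p -> unit_circle q ->
  unit_circle u -> unit_circle v -> p <> q ->
  closed_segment p q = closed_segment u v ->
  (p = u /\ q = v) \/ (p = v /\ q = u).
Proof.
move=> Up Uq Uu Uv pq e.
have [|] : p = u \/ p = v.
- by apply: unit_circle_strictly_convex => //; rewrite -e;
    exact: closed_segment_left.
- have [|] : q = u \/ q = v.
  + by apply: unit_circle_strictly_convex => //; rewrite -e;
      exact: closed_segment_right.
  + by move=> qv pv; case: pq; rewrite pv qv.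
  + by left.
- have [|] : q = u \/ q = v.
  + by apply: unit_circle_strictly_convex => //; rewrite -e;
      exact: closed_segment_right.
  + by right.
  + by move=> qv pv; case: pq; rewrite pv qv.
Qed.

(** * Parametrisation of the circle by [[0, 1[] *)

Lemma circle_point_unit (t : R) : unit_circle (circle_point t).
Proof. by rewrite /unit_circle /= !mxE /= cos2Dsin2. Qed.

Lemma orient_circle_point (a b c : R) :
  orient (circle_point a) (circle_point b) (circle_point c) =
  4 * sin (pi * (b - a)) * sin (pi * (c - b)) * sin (pi * (c - a)).
Proof.
rewrite /orient !mxE /=.
(* Halving the angles makes both sides polynomials in the cosines and sines of [pi * a], [pi * b],
   [pi * c]. *)
have dbl (x : R) : 2 * pi * x = pi * x + pi * x by ring.
rewrite !(mulrBr pi) !sinB !dbl !sinD !cosD.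
have ea := cos2Dsin2 (pi * a); have eb := cos2Dsin2 (pi * b).
have ec := cos2Dsin2 (pi * c).
move: ea eb ec; move: (cos (pi * a)) (sin (pi * a)) (cos (pi * b))
  (sin (pi * b)) (cos (pi * c)) (sin (pi * c)) => ca sa cb sb cc sc ea eb ec.
(* Vandermonde determinant, homogenised with [cos ^ 2 + sin ^ 2 = 1]. *)
have vdm : forall wa wb wc : R, ca ^+ 2 + sa ^+ 2 = wa ->
    cb ^+ 2 + sb ^+ 2 = wb -> cc ^+ 2 + sc ^+ 2 = wc ->
    ((cb * cb - sb * sb) * wa - (ca * ca - sa * sa) * wb) *
    ((sc * cc + cc * sc) * wa - (sa * ca + ca * sa) * wc) -
    ((sb * cb + cb * sb) * wa - (sa * ca + ca * sa) * wb) *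
    ((cc * cc - sc * sc) * wa - (ca * ca - sa * sa) * wc) =
    wa * (4 * (sb * ca - cb * sa) * (sc * cb - cc * sb) * (sc * ca - cc * sa)).
  by move=> _ _ _ <- <- <-; ring.
by have := vdm _ _ _ ea eb ec; rewrite !mulr1 mul1r.
Qed.

Lemma sin_pi_itv_gt0 (a b : R) : 0 <= a -> a < b -> b < 1 ->
  0 < sin (pi * (b - a)).
Proof.
move=> a0 ab b1; have pi0 := pi_gt0 R; apply: sin_gt0_pi; apply/andP; split.
  by rewrite mulr_gt0// subr_gt0.
by rewrite -[ltRHS]mulr1 ltr_pM2l//; lra.
Qed.

Lemma orient_circle_point_gt0 (a b c : R) : 0 <= a -> a < b -> b < c -> c < 1 ->
  0 < orient (circle_point a) (circle_point b) (circle_point c).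
Proof.
move=> a0 ab bc c1; rewrite orient_circle_point !mulr_gt0//.
- by apply: sin_pi_itv_gt0 => //; exact: lt_trans bc c1.
- by apply: sin_pi_itv_gt0 => //; lra.
- by apply: sin_pi_itv_gt0 => //; lra.
Qed.

Lemma orient_swap p q r : orient p r q = - orient p q r.
Proof. by rewrite /orient; ring. Qed.

Lemma orient_rot p q r : orient q r p = orient p q r.
Proof. by rewrite /orient; ring. Qed.

Lemma circle_point_neq (a b : R) : 0 <= a -> a < b -> b < 1 ->
  circle_point a <> circle_point b.
Proof.
move=> a0 ab b1 e.
(* With the midpoint parameter between [a] and [b] the orientation is positive, yet it vanishes when
   two of the three points coincide. *)
have := @orient_circle_point_gt0 a ((a + b) / 2) b a0 ltac:(lra) ltac:(lra) b1.
by rewrite e /orient !subrr !mulr0 subrr ltxx.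
Qed.

Lemma circle_point_inj (a b : R) : 0 <= a < 1 -> 0 <= b < 1 ->
  circle_point a = circle_point b -> a = b.
Proof.
move=> /andP[a0 a1] /andP[b0 b1] e; have [ab|ab|//] := ltgtP a b.
  by case: (circle_point_neq a0 ab b1).
by case: (circle_point_neq b0 ab a1).
Qed.

(** [acos] of the first coordinate is the angle on the upper half circle; on the lower half its
    complement to [2 * pi] is taken. *)
Lemma circle_point_surj p : unit_circle p ->
  exists2 t : R, 0 <= t < 1 & p = circle_point t.
Proof.
rewrite /unit_circle /= => Up.
have x1 : -1 <= p 0 0 <= 1.
  by apply/andP; split; have := sqr_ge0 (p 0 1); nra.
have pi0 := pi_gt0 R.
have scale (x : R) : 2 * pi * (x / (2 * pi)) = x.
  by rewrite mulrC divfK// mulf_neq0// gt_eqF.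
have [cx sx] : cos (acos (p 0 0)) = p 0 0 /\ sin (acos (p 0 0)) = `|p 0 1|.
  rewrite acosK ?in_itv//= sin_acos// (_ : 1 - _ = p 0 1 ^+ 2) ?sqrtr_sqr//.
  by rewrite -Up; ring.
have theta0 := acos_ge0 x1; have thetapi := acos_lepi x1.
have [y0|y0] := leP 0 (p 0 1).
  exists (acos (p 0 0) / (2 * pi)).
    by rewrite divr_ge0 ?ltr_pdivrMr/=; lra.
  by apply: eq_row2; rewrite !mxE /= scale ?cx// sx ger0_norm.
(* A zero angle would give the excluded parameter 1. *)
have theta_gt0 : 0 < acos (p 0 0).
  apply: acos_gt0.
  have y2 : 0 < p 0 1 ^+ 2 by rewrite expr2 nmulr_rgt0.
  by case/andP: x1 => -> x1; rewrite lt_neqAle x1 andbT; apply/eqP => xe;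
    move: Up; rewrite xe; lra.
exists ((2 * pi - acos (p 0 0)) / (2 * pi)).
  by rewrite divr_ge0 ?ltr_pdivrMr/=; lra.
apply: eq_row2; rewrite !mxE /= scale addrC (mulr_natl pi 2).
  by rewrite cosD2pi cosN cx.
by rewrite sinD2pi sinN sx ltr0_norm// opprK.
Qed.

(** * Chords described by increasing pairs of parameters *)

Definition circle_chord (s t : R) :=
  closed_segment (circle_point s) (circle_point t).

(** By symmetry [s <= u]. Chords with a common endpoint meet; otherwise [s < u], and they are
    disjoint if [t < u] (side by side) or [v < t] (nested), and cross if [u < t < v]. *)
Lemma circle_chords_meet (s t u v : R) :
  0 <= s -> s < t -> t < 1 -> 0 <= u -> u < v -> v < 1 ->
  circle_chord s t `&` circle_chord u v !=set0 <->
  (s <= u <= t) && (t <= v) || (u <= s <= v) && (v <= t).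
Proof.
move=> s0 st t1 u0 uv v1.
wlog su : s t u v s0 st t1 u0 uv v1 / s <= u => [sym|].
  have /orP[su|us] := le_total s u; first exact: sym.
  by rewrite setIC orbC; exact: sym.
have O := orient_circle_point_gt0.
have [eq_su|su'] := eqVneq s u.
  subst u; split=> _; last by exists (circle_point s);
    split; exact: closed_segment_left.
  by rewrite !lexx !(ltW st) !(ltW uv) /= le_total.
have {su'} su : s < u by rewrite lt_neqAle su'.
rewrite (ltW su) (leNgt u s) su /= orbF.
have [tu|tu|tu] := ltgtP t u.
- split=> //; apply: contraPP => _; apply: closed_segments_disjoint.
  by apply: mulr_gt0; apply: O => //; lra.
- have [tv|tv|tv] := ltgtP t v.
  + split=> // _; apply: closed_segments_cross.
      (* Swaps and rotations put each triple in increasing order, where the determinant is positive,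
         so only the signs of the permutations remain. *)
      rewrite (orient_swap (circle_point s) (circle_point u)) mulNr oppr_lt0.
      by apply: mulr_gt0; apply: O => //; lra.
    rewrite (orient_rot (circle_point s)) (orient_swap _ (circle_point t)).
    by rewrite mulrN oppr_lt0; apply: mulr_gt0; apply: O => //; lra.
  + split=> //; apply: contraPP => _; apply: closed_segments_disjoint.
    rewrite orient_swap [X in _ * X]orient_swap mulrNN.
    by apply: mulr_gt0; apply: O => //; lra.
  + split=> // _; exists (circle_point t); split.
      exact: closed_segment_right.
    by rewrite tv; exact: closed_segment_right.
- subst u; split=> [_|_]; first by rewrite ltW.
  exists (circle_point t); split; first exact: closed_segment_right.
  exact: closed_segment_left.
Qed.

Lemma circle_chord_inj (s t u v : R) :
  0 <= s -> s < t -> t < 1 -> 0 <= u -> u < v -> v < 1 ->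
  circle_chord s t = circle_chord u v -> s = u /\ t = v.
Proof.
move=> s0 st t1 u0 uv v1.
have inj := circle_point_inj.
case/chord_endpoints; try exact: circle_point_unit.
- exact: circle_point_neq.
- by move=> [] /inj -> => [/inj ->| |]; try lra; split.
(* Matching the endpoints in reverse would give [s < t = u < v = s]. *)
- move=> [/inj sv /inj tu].
  have := sv ltac:(lra) ltac:(lra); have := tu ltac:(lra) ltac:(lra); lra.
Qed.

Lemma chord_circle_chord (C : set 'rV[R]_2) : chords C ->
  exists st : R * R, [/\ 0 <= st.1, st.1 < st.2, st.2 < 1 &
    C = circle_chord st.1 st.2].
Proof.
move=> [p [q [/circle_point_surj[s /andP[s0 s1] ->]]]].
move=> /circle_point_surj[t /andP[t0 t1] ->] pq ->.
have [st|ts|st] := ltgtP s t; last by rewrite st in pq.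
  by exists (s, t).
by exists (t, s); split=> //=; rewrite closed_segmentC.
Qed.

End Plane.

(** * Countability of the rational circle graph, and transport of chords to rational ones *)

Section Transport.
Variable R : realType.

Lemma chords_between_sub (E F : set 'rV[R]_2) : E `<=` F ->
  chords_between E `<=` chords_between F.
Proof. by move=> EF C [p [q [/EF Fp /EF Fq pq ->]]]; exists p, q. Qed.

Lemma rational_circle_graph_circle :
  circle_graph R (rational_circle_graph R).
Proof.
exists (chords_between (@rational_points R)).
  by apply: chords_between_sub => p [r _ <-]; exact: circle_point_unit.
by exists id; [exists id | split].
Qed.

Lemma rational_circle_graph_countable :
  countable_graph (rational_circle_graph R).
Proof.
rewrite /countable_graph (eq_countable (card_setT _)).
(* Rational chords all lie in the image of the countable type [rat * rat]. *)
pose chord (ab : rat * rat) := circle_chord (ratr ab.1 : R) (ratr ab.2).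
apply: (@sub_countable _ _ _ (range chord)); last first.
  exact: sub_countable (card_image_le _ _) (countableP _).
apply: subset_card_le => C [p [q [[a _ <-] [b _ <-] _ ->]]].
by exists (a, b).
Qed.

Lemma circle_graph_embeds (G : graph) : countable_graph G ->
  circle_graph R G ->
  exists W : set (rational_circle_graph R),
    isomorphic G (induced_subgraph W).
Proof.
move=> cG [A Achords [f [f' ff' f'f] f_adj]].
have /choice[st st_chord] (x : G) : exists st : R * R,
    [/\ 0 <= st.1, st.1 < st.2, st.2 < 1 & val (f x) = circle_chord st.1 st.2].
  by apply: chord_circle_chord; apply: Achords; exact: set_valP.
(* All parameters of endpoints of the chords that represent [G]. *)
pose S := \bigcup_(x in [set: G]) [set (st x).1; (st x).2].
have cS : countable S.
  by apply: bigcup_countable => // x _; exact: finite_set_countable.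
have [e [e_itv e_mono]] := countable_order_embedding cS.
have S1 x : (st x).1 \in S by apply/mem_set; exists x; [|left].
have S2 x : (st x).2 \in S by apply/mem_set; exists x; [|right].
have e_lt := leW_mono_in e_mono.
pose h x := circle_chord (ratr (e (st x).1) : R) (ratr (e (st x).2)).
have h_itv x : [/\ 0 <= ratr (e (st x).1) :> R,
    ratr (e (st x).1) < ratr (e (st x).2) :> R & ratr (e (st x).2) < 1 :> R].
  have [s0 st_lt t1 _] := st_chord x.
  rewrite ler0q ltr_rat e_lt// st_lt -[X in _ < X](ratr_nat R 1) ltr_rat.
  by have /andP[-> _] := e_itv (st x).1; have /andP[_ ->] := e_itv (st x).2.
have h_rat x : chords_between (@rational_points R) (h x).
  have [s0 lt_st t1] := h_itv x.
  have /andP[e10 /ltW e11] := e_itv (st x).1.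
  have /andP[e20 /ltW e21] := e_itv (st x).2.
  exists (circle_point (ratr (e (st x).1))), (circle_point (ratr (e (st x).2))).
  split=> //.
  - by exists (e (st x).1) => //=; rewrite e10.
  - by exists (e (st x).2) => //=; rewrite e20.
  - exact: circle_point_neq.
pose hv x : rational_circle_graph R := SigSub (mem_set (h_rat x)).
(* Adjacency requires distinct chords, so injectivity is needed besides preservation of meeting. *)
have h_inj : injective hv.
  move=> x y /(congr1 val) /= hxy; apply: (can_inj ff'); apply: val_inj.
  have [x0 xlt x1 ->] := st_chord x; have [y0 ylt y1 ->] := st_chord y.
  have [hx0 hxlt hx1] := h_itv x; have [hy0 hylt hy1] := h_itv y.
  have [] := circle_chord_inj hx0 hxlt hx1 hy0 hylt hy1 hxy.
  have e_inj := inc_inj_in e_mono.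
  by move=> /(fmorph_inj _) /e_inj -> // /(fmorph_inj _) /e_inj ->.
(* The criterion for meeting involves only [<=] between parameters, which [e] on [S] and [ratr] both
   preserve and reflect. *)
have h_meet x y : h x `&` h y !=set0 <-> val (f x) `&` val (f y) !=set0.
  have [x0 xlt x1 ->] := st_chord x; have [y0 ylt y1 ->] := st_chord y.
  have [hx0 hxlt hx1] := h_itv x; have [hy0 hylt hy1] := h_itv y.
  by rewrite !circle_chords_meet// !ler_rat !e_mono.
have h_adj x y : adj (hv x) (hv y) <-> adj x y.
  rewrite -f_adj; split=> -[xy meet].
    by split; [move=> /(can_inj ff') exy; case: xy; rewrite exy|exact/h_meet].
  by split; [move=> /h_inj exy; case: xy; rewrite exy|exact/h_meet].
pose W : set (rational_circle_graph R) := range hv.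
have hW x : W (hv x) by exists x.
exists W, (fun x => SigSub (mem_set (hW x))).
  rewrite -setTT_bijective; split=> //.
    by move=> x y _ _ /(congr1 val) /h_inj.
  move=> w _; have [x _ xw] := set_valP w.
  by exists x => //; apply: val_inj.
by move=> x y; exact: h_adj.
Qed.

End Transport.

Theorem theorem1p3 (R : realType) :
  strongly_universal
    (fun G : graph => countable_graph G /\ circle_graph R G)
    (rational_circle_graph R).
Proof.
split; last by move=> G [cG]; exact: circle_graph_embeds.
split; first exact: rational_circle_graph_countable.
exact: rational_circle_graph_circle.
Qed.
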